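(* Let a Boolean control network $x(t+1)=Lu(t)x(t)$, $y(t)=Hx(t)$ be given, let $\mathcal{G}=(\mathcal{V},\mathcal{E},\mathcal{W})$ be its weighted pair graph and let $\mathcal{V}_n$ be the set of all non-diagonal vertices of $\mathcal{G}$. The network is not Type-3 observable if and only if the deterministic finite automaton $A_{\mathcal{V}_n}$ recognizes the language $(\Delta_M)^*$ of all finite words over $\Delta_M$.
   Context: Fix positive integers $n,m,q$ and put $N=2^n$, $M=2^m$, $Q=2^q$. For a positive integer $k$, $\delta_k^i$ is the $i$-th column of the identity matrix $I_k$ and $\Delta_k=\{\delta_k^1,\dots,\delta_k^k\}$. A logical matrix of size $k\times s$ is one all of whose columns lie in $\Delta_k$. A Boolean control network (BCN, in algebraic form) is a system $x(t+1)=Lu(t)x(t)$, $y(t)=Hx(t)$, $t=0,1,2,\dots$, with states $x(t)\in\Delta_N$, inputs $u(t)\in\Delta_M$, outputs $y(t)\in\Delta_Q$, where $L$ is an $N\times NM$ logical matrix and $H$ is a $Q\times N$ logical matrix. Products are semi-tensor products; concretely $Lux=L(u\otimes x)$ for $u\in\Delta_M$, $x\in\Delta_N$, with $\otimes$ the Kronecker product. For $x_0\in\Delta_N$, $p\ge 1$ and $U=u_0\cdots u_{p-1}\in(\Delta_M)^p$, put $x_{t+1}=Lu_tx_t$ for $0\le t<p$ and $(HL)_{x_0}^p(U)=(Hx_1)\cdots(Hx_p)\in(\Delta_Q)^p$. Type-3 observability: there exist $p\ge1$ and $U\in(\Delta_M)^p$ such that for any distinct $x_0,\bar x_0\in\Delta_N$,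 $Hx_0=H\bar x_0$ implies $(HL)_{x_0}^p(U)\neq(HL)_{\bar x_0}^p(U)$. Weighted pair graph $\mathcal{G}=(\mathcal{V},\mathcal{E},\mathcal{W})$: $\mathcal{V}$ is the set of unordered pairs $(x,x')$ (so $(x,x')=(x',x)$, and $x=x'$ is allowed) of elements of $\Delta_N$ with $Hx=Hx'$. For vertices $v=(x_1,x_1')$, $w=(x_2,x_2')$, let $\mathcal{W}((v,w))$ be the set of $u\in\Delta_M$ such that ($Lux_1=x_2$ and $Lux_1'=x_2'$) or ($Lux_1=x_2'$ and $Lux_1'=x_2$). The directed edge $(v,w)$ belongs to $\mathcal{E}$ iff this set is nonempty, and then it is the weight of the edge. A vertex $(x,x)$ is called diagonal; the other vertices are non-diagonal. A deterministic finite automaton (DFA) is $A=(S,\Sigma,\sigma,s_0,F)$ with finite state set $S$, finite nonempty alphabet $\Sigma$, initial state $s_0\in S$, final states $F\subset S$, and a partial transition function $\sigma:S\times\Sigma\to S$, extended naturally to a partial function $S\times\Sigma^*\to S$, where $\Sigma^*$ is the set of all finite words including the empty word. The language recognized by $A$ is $L(A)=\{w\in\Sigma^*\mid \sigma(s_0,w)\text{ is defined and lies in }F\}$. The DFA $A_{\mathcal{V}_n}$: its alphabet is $\Delta_M$; its states are subsets of $\mathcal{V}$; its initial state is $\mathcal{V}_n$. For a state $s$ and a letter $\delta_M^j$, let $s'=\{v\in\mathcal{V}\mid \text{there is } v'\in s\text{ with }(v',v)\in\mathcal{E}\text{ and }\delta_M^j\in\mathcal{W}((v',v))\}$; if $s'\neq\emptyset$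 then the transition function at $(s,\delta_M^j)$ takes the value $s'$, and otherwise it is undefined there. The state set consists of $\mathcal{V}_n$ and all sets obtained from it by repeatedly applying these transitions. All states are final. *)

(* Defs.v *)
From HB Require Import structures.
From mathcomp Require Import all_boot all_algebra.
From mathcomp Require Import mxtens.

Set Implicit Arguments.
Unset Strict Implicit.
Unset Printing Implicit Defensive.

Import GRing.Theory.
Local Open Scope ring_scope.

Definition delta_cols (k : nat) : seq 'cV[int]_k :=
  [seq col i 1%:M | i <- enum 'I_k].

Notation Delta k := (seq_sub (delta_cols k)).

Definition logical_mx k s (A : 'M[int]_(k, s)) : Prop :=
  forall j : 'I_s, col j A \in delta_cols k.

Lemma delta_colsP k (v : 'cV[int]_k) :
  reflect (exists i : 'I_k, v = col i 1%:M) (v \in delta_cols k).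
Proof.
apply: (iffP mapP) => [[i _ ->]|[i ->]]; first by exists i.
by exists i; rewrite // mem_enum.
Qed.

Lemma mem_delta_cols k (i : 'I_k) : col i 1%:M \in delta_cols k.
Proof. by apply/delta_colsP; exists i. Qed.

Lemma mulmx_col1 k s (A : 'M[int]_(k, s)) (i : 'I_s) :
  A *m col i 1%:M = col i A.
Proof. by rewrite colE mul1mx -colE. Qed.

Lemma logical_mulmx k s (A : 'M[int]_(k, s)) (x : 'cV[int]_s) :
  logical_mx A -> x \in delta_cols s -> A *m x \in delta_cols k.
Proof. by move=> lA /delta_colsP[i ->]; rewrite mulmx_col1. Qed.

Lemma tens_delta_cols k s (u : 'cV[int]_k) (x : 'cV[int]_s) :
  u \in delta_cols k -> x \in delta_cols s ->
  (u *t x : 'cV[int]_(k * s)) \in delta_cols (k * s).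
Proof.
move=> /delta_colsP[i ->] /delta_colsP[j ->].
apply/delta_colsP; exists (mxtens_index (i, j)).
apply/matrixP=> r c; case: (mxtens_indexP r) => a b.
rewrite !mxE !mxtens_indexK /= (can_eq (@mxtens_indexK k s)) xpair_eqE.
by rewrite -natrM mulnb.
Qed.

(* L is declared with 2 ^ m * 2 ^ n columns, the height of u *t x. *)
Record bcn (n m q : nat) := Bcn {
  bcn_L : 'M[int]_(2 ^ n, 2 ^ m * 2 ^ n);
  bcn_H : 'M[int]_(2 ^ q, 2 ^ n);
  bcn_L_logical : logical_mx bcn_L;
  bcn_H_logical : logical_mx bcn_H }.

Section Network.

Context {n m q : nat} (B : bcn n m q).

Lemma bcn_step_subproof (x : Delta (2 ^ n)) (u : Delta (2 ^ m)) :
  bcn_L B *m (ssval u *t ssval x) \in delta_cols (2 ^ n).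
Proof.
apply: logical_mulmx (bcn_L_logical B) _.
by apply: tens_delta_cols; apply: ssvalP.
Qed.

Definition bcn_step (x : Delta (2 ^ n)) (u : Delta (2 ^ m)) : Delta (2 ^ n) :=
  SeqSub (bcn_step_subproof x u).

Definition bcn_out (x : Delta (2 ^ n)) : Delta (2 ^ q) :=
  SeqSub (logical_mulmx (bcn_H_logical B) (ssvalP x)).

(* [scanl bcn_step x0 U] is x_1 ... x_p, without the initial state x_0. *)
Definition HL (p : nat) (x0 : Delta (2 ^ n)) (U : p.-tuple (Delta (2 ^ m))) :
    p.-tuple (Delta (2 ^ q)) :=
  [tuple of map bcn_out (scanl bcn_step x0 U)].

Definition type3_observable : Prop :=
  exists2 p : nat, (0 < p)%N &
  exists U : p.-tuple (Delta (2 ^ m)),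
  forall x0 x0' : Delta (2 ^ n), x0 <> x0' ->
    bcn_out x0 = bcn_out x0' -> HL x0 U <> HL x0' U.

(* An unordered pair (x, x') is the set [set x; x'], a singleton if x = x'. *)
Definition pg_vertices : {set {set Delta (2 ^ n)}} :=
  [set v | [exists x, exists x',
              (v == [set x; x']) && (bcn_out x == bcn_out x')]].

Definition pg_weight (v w : {set Delta (2 ^ n)}) : {set Delta (2 ^ m)} :=
  [set u | [exists x1, exists x1', exists x2, exists x2',
     [&& v == [set x1; x1'], w == [set x2; x2'] &
         ((bcn_step x1 u == x2) && (bcn_step x1' u == x2')) ||
         ((bcn_step x1 u == x2') && (bcn_step x1' u == x2))]]].

Definition pg_edge (v w : {set Delta (2 ^ n)}) : bool :=
  [&& v \in pg_vertices, w \in pg_vertices & pg_weight v w != set0].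

Definition diagonal (v : {set Delta (2 ^ n)}) : bool :=
  [exists x, v == [set x; x]].

Definition nondiag_vertices : {set {set Delta (2 ^ n)}} :=
  [set v in pg_vertices | ~~ diagonal v].

End Network.

Record dfa (Sigma : finType) := Dfa {
  dfa_state : finType;
  dfa_alphabet_gt0 : (0 < #|Sigma|)%N;
  dfa_trans : dfa_state -> Sigma -> option dfa_state;
  dfa_init : dfa_state;
  dfa_final : {set dfa_state} }.

Fixpoint dfa_run (Sigma : finType) (A : dfa Sigma) (s : dfa_state A)
    (w : seq Sigma) : option (dfa_state A) :=
  if w is a :: w' then
    if dfa_trans s a is Some s' then dfa_run s' w' else None
  else Some s.

Definition dfa_language (Sigma : finType) (A : dfa Sigma) : pred (seq Sigma) :=
  fun w => if dfa_run (dfa_init A) w is Some s then s \in dfa_final A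
           else false.

Definition recognizes (Sigma : finType) (A : dfa Sigma)
    (K : pred (seq Sigma)) : Prop :=
  dfa_language A =1 K.

Lemma card_Delta_gt0 k : (0 < k)%N -> (0 < #|{: Delta k}|)%N.
Proof.
case: k => // k _; apply/card_gt0P.
by exists (SeqSub (mem_delta_cols (ord0 : 'I_k.+1))).
Qed.

Section Automaton.

Context {n m q : nat} (B : bcn n m q).

Definition AVn_succ (s : {set {set Delta (2 ^ n)}}) (a : Delta (2 ^ m)) :
    {set {set Delta (2 ^ n)}} :=
  [set v in pg_vertices B |
     [exists v' in s, pg_edge B v' v && (a \in pg_weight B v' v)]].

Definition AVn_rel : rel {set {set Delta (2 ^ n)}} :=
  fun s t => [exists a, (t == AVn_succ s a) && (t != set0)].

Definition AVn_states : {set {set {set Delta (2 ^ n)}}} :=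
  [set s | connect AVn_rel (nondiag_vertices B) s].

Definition AVn_state : finType := {s | s \in AVn_states}.

Lemma AVn_init_subproof : nondiag_vertices B \in AVn_states.
Proof. by rewrite inE connect0. Qed.

Definition AVn_init : AVn_state :=
  exist (fun s => s \in AVn_states) _ AVn_init_subproof.

(* [insub] never fails here, see [AVn_transE]. *)
Definition AVn_trans (s : AVn_state) (a : Delta (2 ^ m)) : option AVn_state :=
  if AVn_succ (val s) a != set0 then insub (AVn_succ (val s) a) else None.

Lemma AVn_transE (s : AVn_state) (a : Delta (2 ^ m)) :
  omap val (AVn_trans s a) =
  if AVn_succ (val s) a != set0 then Some (AVn_succ (val s) a) else None.
Proof.
rewrite /AVn_trans; case: ifP => // ne; rewrite insubT //=.
have := valP s; rewrite !inE => /connect_trans; apply.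
by apply: connect1; apply/existsP; exists a; rewrite eqxx ne.
Qed.

Lemma AVn_alphabet_gt0 : (0 < #|{: Delta (2 ^ m)}|)%N.
Proof. by apply: card_Delta_gt0; rewrite expn_gt0. Qed.

Definition AVn : dfa (Delta (2 ^ m)) :=
  {| dfa_state := AVn_state;
     dfa_alphabet_gt0 := AVn_alphabet_gt0;
     dfa_trans := AVn_trans;
     dfa_init := AVn_init;
     dfa_final := setT |}.

End Automaton.

(* Main.v *)
Require Import Defs.
From mathcomp Require Import all_boot all_algebra.

(** Fix a nonempty input word [w].  Say that two states are confused by [w]
if they have equal outputs and [w] makes them produce equal output words.  The
network fails to be Type-3 observable iff every nonempty word confuses two
distinct states, and the automaton accepts every word iff its run survives on
every word, so it suffices to show, for each nonempty [w], that the run on [w]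
survives iff [w] confuses two distinct states ([AVn_accepts_cons]).

The reason is that a letter [a] acts on the states of the automaton by taking
images: a set [s] of vertices goes to the images, under the one-step map of
input [a], of those vertices in [s] whose image is again a vertex, that is,
whose two members still have equal outputs after the step
([mem_AVn_succ]).  Hence the word [w] leads [s] to a nonempty set iff some pair
in [s] produces equal outputs all along [w] ([foldl_AVn_succ_neq0]).
A pair may merge into a diagonal vertex on the way, and then it remains a
vertex forever, in agreement with the fact that merged trajectories are never
told apart again.

The empty word is always accepted, and Type-3 observability only concerns
nonempty words, so it imposes nothing on either side. *)

(** An unordered pair determines its two members up to order, so whether a
function takes equal values on them depends on the pair alone.  Through this
fact the swapped case in the definition of the weights never has to be
considered separately. *)
Lemma eq_on_set2 (T : finType) (S : Type) (g : T -> S) (x x' y y' : T) :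
  [set x; x'] = [set y; y'] -> g y = g y' -> g x = g x'.
Proof.
move=> /setP e gy.
have: x \in [set y; y'] by rewrite -e set21.
have: x' \in [set y; y'] by rewrite -e set22.
by case/set2P=> ->; case/set2P=> ->.
Qed.

Section PairGraph.

Context {n m q : nat} (B : bcn n m q).

Implicit Types (x y : Delta (2 ^ n)) (a : Delta (2 ^ m)).
Implicit Types (v : {set Delta (2 ^ n)}) (s : {set {set Delta (2 ^ n)}}).
Implicit Types (w : seq (Delta (2 ^ m))).

Lemma set2_pg_vertices x x' :
  ([set x; x'] \in pg_vertices B) = (bcn_out B x == bcn_out B x').
Proof.
rewrite inE; apply/idP/idP => [|e].
  by case/existsP=> y /existsP[y' /andP[/eqP e /eqP o]];
    apply/eqP; apply: eq_on_set2 e o.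
by apply/existsP; exists x; apply/existsP; exists x'; rewrite eqxx.
Qed.

Lemma pg_verticesP v :
  reflect (exists x x', v = [set x; x'] /\ bcn_out B x = bcn_out B x')
          (v \in pg_vertices B).
Proof.
apply: (iffP idP) => [|[x [x' [-> o]]]]; last by rewrite set2_pg_vertices o.
rewrite inE => /existsP[x /existsP[x' /andP[/eqP -> /eqP o]]].
by exists x, x'.
Qed.

Lemma set2_nondiag x x' :
  ([set x; x'] \in nondiag_vertices B)
  = (bcn_out B x == bcn_out B x') && (x != x').
Proof.
rewrite inE set2_pg_vertices; congr (_ && ~~ _).
apply/existsP/eqP => [[y /eqP e]|->]; last by exists x'.
exact: (@eq_on_set2 _ _ id _ _ _ _ e).
Qed.

Lemma imset_step_set2 a x x' :
  (bcn_step B)^~ a @: [set x; x'] = [set bcn_step B x a; bcn_step B x' a].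
Proof. by rewrite imsetU1 imset_set1. Qed.

(** Both alternatives in the definition of the weights describe the image of
the pair under the step of input [a], since the target is unordered. *)
Lemma mem_pg_weight v v' a :
  v \in pg_vertices B ->
  (a \in pg_weight B v v') = (v' == (bcn_step B)^~ a @: v).
Proof.
case/pg_verticesP=> x [x' [-> _]]; rewrite inE; apply/idP/eqP => [|->].
  case/existsP=> x1 /existsP[x1' /existsP[x2 /existsP[x2']]].
  case/and3P=> /eqP -> /eqP ->; rewrite imset_step_set2.
  by case/orP=> /andP[/eqP -> /eqP ->] //; rewrite setUC.
rewrite imset_step_set2; apply/existsP; exists x; apply/existsP; exists x'.
apply/existsP; exists (bcn_step B x a); apply/existsP; exists (bcn_step B x' a).
by rewrite !eqxx.
Qed.

Lemma mem_AVn_succ s a v : s \subset pg_vertices B ->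
  (v \in AVn_succ B s a)
  = (v \in pg_vertices B) &&
    (v \in [set (bcn_step B)^~ a @: v' | v' : {set Delta (2 ^ n)} in s]).
Proof.
move=> /subsetP sV; rewrite inE; case vV: (v \in pg_vertices B) => //=.
apply/existsP/imsetP => [[v' /and3P[v's _]]|[v' v's e]].
  by rewrite (mem_pg_weight _ _ _ (sV _ v's)) => /eqP ->; exists v'.
have av: a \in pg_weight B v' v.
  by rewrite (mem_pg_weight _ _ _ (sV _ v's)) e.
exists v'; rewrite v's /pg_edge (sV _ v's) vV av !andbT /=.
by apply/set0Pn; exists a.
Qed.

Lemma AVn_succ_sub s a : AVn_succ B s a \subset pg_vertices B.
Proof. by apply/subsetP => v; rewrite inE => /andP[]. Qed.

Lemma AVn_succ0 a : AVn_succ B set0 a = set0.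
Proof.
apply/setP=> v; rewrite !inE; apply/negbTE; rewrite negb_and; apply/orP; right.
by apply/existsPn => v'; rewrite inE.
Qed.

Lemma foldl_AVn_succ0 w : foldl (AVn_succ B) set0 w = set0.
Proof. by elim: w => //= a w; rewrite AVn_succ0. Qed.

(** The same output word as [HL], for an input word of unspecified length, so
that induction on the word is possible. *)
Definition output_word x w : seq (Delta (2 ^ q)) :=
  [seq bcn_out B y | y <- scanl (bcn_step B) x w].

(** By induction on [w]: the pairs that survive the first letter are the
images of pairs in [s] whose outputs agree after one step. *)
Lemma foldl_AVn_succ_neq0 w s : s \subset pg_vertices B ->
  foldl (AVn_succ B) s w != set0 <->
  exists x x', [set x; x'] \in s /\ output_word x w = output_word x' w.
Proof.
elim: w s => [|a w IH] s sV /=.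
  split=> [/set0Pn[v vs]|[x [x' [xs _]]]]; last first.
    by apply/set0Pn; exists [set x; x'].
  have /pg_verticesP[x [x' [e _]]] := subsetP sV _ vs.
  by exists x, x'; rewrite -e.
apply: (iff_trans (IH _ (AVn_succ_sub s a))); split.
  case=> y [y' []]; rewrite mem_AVn_succ // set2_pg_vertices.
  case/andP=> /eqP oy /imsetP[v vs].
  have /pg_verticesP[x [x' [ev _]]] := subsetP sV _ vs.
  rewrite ev imset_step_set2 => /esym e ow.
  exists x, x'; split; first by rewrite -ev.
  rewrite /output_word /=; congr (_ :: _).
    exact: eq_on_set2 e oy.
  exact: (@eq_on_set2 _ _ (output_word^~ w) _ _ _ _ e ow).
case=> x [x' [xs [o ow]]].
exists (bcn_step B x a), (bcn_step B x' a); split=> //.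
rewrite mem_AVn_succ // set2_pg_vertices /=.
apply/andP; split; first by apply/eqP; apply: val_inj.
by apply/imsetP; exists [set x; x']; rewrite ?imset_step_set2.
Qed.

(** Since the empty set has only empty successors, testing emptiness at the end
of the run tests it at every step.  The exception of the empty word is needed
because the initial state may be the empty set. *)
Lemma dfa_run_AVn (t : AVn_state B) w :
  isSome (dfa_run (A := AVn B) t w)
  = (w == [::]) || (foldl (AVn_succ B) (val t) w != set0).
Proof.
elim: w t => [|a w IH] t //=.
have := AVn_transE t a; case: (AVn_trans t a) => [t'|] /=; last first.
  by case: eqP => //= -> _; rewrite foldl_AVn_succ0 eqxx.
case: ifP => // ne [e]; rewrite IH /= e.
by case: w {IH} => //=; rewrite ne.
Qed.

Lemma AVn_accepts w :
  dfa_language (AVn B) w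
  = (w == [::]) || (foldl (AVn_succ B) (nondiag_vertices B) w != set0).
Proof.
rewrite -(dfa_run_AVn (AVn_init B)) /dfa_language /=.
by case: dfa_run => //= t; rewrite inE.
Qed.

Lemma AVn_accepts_cons a w :
  dfa_language (AVn B) (a :: w) <->
  exists x x', [/\ x <> x', bcn_out B x = bcn_out B x' &
                   output_word x (a :: w) = output_word x' (a :: w)].
Proof.
have sV: nondiag_vertices B \subset pg_vertices B.
  by apply/subsetP => v; rewrite inE => /andP[].
rewrite AVn_accepts; apply: (iff_trans (foldl_AVn_succ_neq0 (a :: w) _ sV)).
split=> [[x [x' []]]|[x [x' [/eqP ne /eqP o e]]]].
  by rewrite set2_nondiag => /andP[/eqP o /eqP ne] e; exists x, x'.
by exists x, x'; rewrite set2_nondiag ne o.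
Qed.

End PairGraph.

Theorem mainTheorem5 (n m q : nat) (hn : (0 < n)%N) (hm : (0 < m)%N)
    (hq : (0 < q)%N) (B : bcn n m q) :
  ~ type3_observable B <-> recognizes (AVn B) predT.
Proof.
split=> [notO [|a w] | acc [p p0 [U obsU]]].
- by rewrite AVn_accepts.
- (* A rejected nonempty word would itself witness Type-3 observability. *)
  case acc: (dfa_language _ _) => //; case: notO.
  exists (size w).+1 => //; exists (in_tuple (a :: w)) => x x' ne o e.
  suff: dfa_language (AVn B) (a :: w) by rewrite acc.
  apply/AVn_accepts_cons; exists x, x'; split=> //.
  exact: (congr1 val e).
- have eU: size U = p by rewrite size_tuple.
  have := acc U; case E: (tval U) eU => [|a w] eU; first by rewrite -eU in p0.
  move/AVn_accepts_cons => [x [x' [ne o e]]].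
  by apply: (obsU x x' ne o); apply: val_inj; rewrite /= E.
Qed.
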